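(* Let $n\ge 2$ and let $k_1,\dots,k_n\ge 3$ be integers. Let $\mathcal{H}_{\{k_1-1,\dots,k_n-1\}}$ be the hinge graph obtained by gluing cycle graphs with $k_1,\dots,k_n$ vertices along one common edge. Put $a:=(k_1-1)\cdots(k_n-1)$. Then $$|K(\mathcal{H}_{\{k_1-1,\dots,k_n-1\}})| = a + \frac{a}{k_1-1} + \cdots + \frac{a}{k_n-1}.$$
   Context: The hinge graph $\mathcal{H}_{\{k_1-1,\dots,k_n-1\}}$ is the simple graph with two distinguished (''shared'') vertices $x,y$ joined by an edge $xy$, together with $n$ internally vertex-disjoint paths from $x$ to $y$, the $i$-th path having $k_i-2$ internal vertices (so the $i$-th path together with $xy$ is a cycle with $k_i$ vertices). The critical group $K(G)$ of a finite connected graph $G$ is the group of degree-zero divisors modulo the image of the graph Laplacian (the torsion part of the cokernel of the Laplacian); its order equals the number of spanning trees of $G$. *)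

(* Defs.v *)
From HB Require Import structures.
From mathcomp Require Import all_boot all_order all_algebra.
From mathcomp Require Import mathcomp_extra boolp classical_sets functions.
From mathcomp Require Import cardinality.

Set Implicit Arguments.
Unset Strict Implicit.
Unset Printing Implicit Defensive.

Import GRing.Theory.

Record sgraph := SGraph {
  vertex :> finType;
  adj : rel vertex;
  adj_sym : symmetric adj;
  adj_irr : irreflexive adj
}.

Section CriticalGroup.

Local Open Scope ring_scope.

Variable G : sgraph.

Definition divisor := {ffun G -> int}.

Definition laplacian (f : divisor) : divisor :=
  [ffun v => f v *+ #|[pred w | adj v w]| - \sum_(w | adj v w) f w].

Definition degree (D : divisor) : int := \sum_v D v.

Lemma laplacianB : {morph laplacian : f g / f - g}.
Proof.
move=> f g; apply/ffunP => v; rewrite !ffunE mulrnDl mulNrn.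
under eq_bigr => w _ do rewrite !ffunE.
by rewrite big_split /= sumrN !opprD opprK -!addrA; congr (_ + _); rewrite addrCA.
Qed.

Lemma laplacian0 : laplacian 0 = 0.
Proof. by rewrite -[X in laplacian X](subrr 0) laplacianB subrr. Qed.

Lemma degreeB : {morph degree : D E / D - E}.
Proof.
move=> D E; rewrite /degree -sumrB.
by apply: eq_bigr => v _; rewrite !ffunE.
Qed.

Lemma degree_laplacian f : degree (laplacian f) = 0.
Proof.
rewrite /degree /laplacian.
under eq_bigr => v _ do rewrite ffunE.
rewrite sumrB [X in _ - X](exchange_big_dep xpredT) //=.
apply/eqP; rewrite subr_eq0; apply/eqP; apply: eq_bigr => v _.
by rewrite sumr_const; congr (_ *+ _); apply: eq_card => w; rewrite !inE adj_sym.
Qed.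

Definition degree0 : {pred divisor} := [pred D | degree D == 0].

Lemma degree0_zmod_closed : zmod_closed degree0.
Proof.
split=> [|D E]; rewrite !inE.
  by rewrite -[X in degree X](subrr 0) degreeB subrr.
by rewrite degreeB => /eqP-> /eqP->; rewrite subrr.
Qed.

HB.instance Definition _ :=
  GRing.isZmodClosed.Build divisor degree0 degree0_zmod_closed.

Record divisor0 := Divisor0 { divisor0_val :> divisor; _ : divisor0_val \in degree0 }.

HB.instance Definition _ := [isSub for divisor0_val].
HB.instance Definition _ := [Choice of divisor0 by <:].
HB.instance Definition _ := [SubChoice_isSubZmodule of divisor0 by <:].

Definition principal : {pred divisor0} :=
  [pred D : divisor0 | `[< exists f, laplacian f = val D >]].

Lemma principal_zmod_closed : zmod_closed principal.
Proof.
split=> [|D E]; first by apply/asboolP; exists 0; rewrite laplacian0 raddf0.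
move=> /asboolP[f fD] /asboolP[g gE]; apply/asboolP.
by exists (f - g); rewrite laplacianB fD gE raddfB.
Qed.

HB.instance Definition _ :=
  GRing.isZmodClosed.Build divisor0 principal principal_zmod_closed.

Definition critical_group : zmodType := Quotient.quot principal.

End CriticalGroup.

Section Hinge.

Variables (n : nat) (l : 'I_n -> nat).

(* [l i] is the number of edges of the i-th path from x to y, which therefore
   has [(l i).-1] internal vertices; [inl false] is x, [inl true] is y, and
   [inr (Tagged _ j)] in path i is at distance [j.+1] from x along that path.
   This is the intended simple graph when every [l i] is at least 2. *)
Definition hinge_vertex : finType := (bool + {i : 'I_n & 'I_(l i).-1})%type.

Definition hinge_end_adj (b : bool) (p : {i : 'I_n & 'I_(l i).-1}) : bool :=
  if b then (tagged p).+2 == l (tag p) else tagged p == 0 :> nat.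

Definition hinge_adj : rel hinge_vertex := fun u v =>
  match u, v with
  | inl b, inl c => b != c
  | inl b, inr p | inr p, inl b => hinge_end_adj b p
  | inr p, inr q =>
      (tag p == tag q) &&
      (((tagged p).+1 == tagged q :> nat) || ((tagged q).+1 == tagged p :> nat))
  end.

Lemma hinge_adj_sym : symmetric hinge_adj.
Proof. by move=> [b|p] [c|q] //=; rewrite eq_sym // orbC. Qed.

Lemma hinge_adj_irr : irreflexive hinge_adj.
Proof.
move=> [b|p] /=; first by rewrite eqxx.
by rewrite eqxx orbb -[X in _ == X]addn0 -addn1 eqn_add2l.
Qed.

Definition hinge : sgraph := SGraph hinge_adj_sym hinge_adj_irr.

End Hinge.

(* Main.v *)
(* In the critical group, harmonicity along path i makes the vertex at distance
   p from x (minus x) equal to p g_i, so K is generated by g_1, ..., g_n and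
   h = y - x subject to l_i g_i = h for all i and h + g_1 + ... + g_n = 0.
   Without the last relation the elements are uniquely c h + sum r_i g_i with
   0 <= r_i < l_i, and adding h + sum g_i raises c by 1 + #{i | r_i = l_i - 1};
   hence the elements with 0 <= c <= #{i | r_i = 0} represent each class once.
   Their number is the sum of 1 + #{i | r_i = 0} over all residues r, which is
   a + sum_i a / l_i. *)
Require Import Defs.
From mathcomp Require Import all_boot all_order all_algebra.
From mathcomp Require Import mathcomp_extra boolp classical_sets functions.
From mathcomp Require Import cardinality.
From mathcomp Require Import zify ring.

Set Implicit Arguments.
Unset Strict Implicit.
Unset Printing Implicit Defensive.

Import Order.TTheory GRing.Theory Num.Theory.

(** * The Laplacian and sums along a path *)

Section Laplacian.
Local Open Scope ring_scope.

Lemma laplacian_sumE (G : sgraph) (f : divisor G) (v : G) :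
  laplacian f v = \sum_(w | adj v w) (f v - f w).
Proof. by rewrite ffunE sumrB sumr_const. Qed.

Lemma sum_neighbours (F : nat -> int) (m j : nat) : (j < m)%N ->
  \sum_(i < m | (j.+1 == i) || (i.+1 == j)) F i =
    (if (j.+1 < m)%N then F j.+1 else 0) + (if (0 < j)%N then F j.-1 else 0).
Proof.
move=> jm; have jP : if (0 < j)%N then \sum_(i < m | i.+1 == j) F i = F j.-1
                     else \sum_(i < m | i.+1 == j) F i = 0.
  case: j jm => [|j] jm /=; first by rewrite big1.
  by under eq_bigl => i do rewrite eqSS; rewrite big_ord1_eq ltnW.
rewrite (bigID (fun i : 'I_m => j.+1 == i)) /=; congr (_ + _).
  by rewrite -(big_ord1_eq +%R F); apply: eq_bigl => i; lia.
transitivity (\sum_(i < m | i.+1 == j) F i); last by case: ifP jP.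
by apply: eq_bigl => i; lia.
Qed.

(** Summation by parts: weighting by position leaves only boundary terms, so the weight of a
    principal divisor on a path depends only on values near its ends. *)
Lemma sum_second_difference (F : nat -> int) (m : nat) :
  \sum_(j < m) (F j.+1 *+ 2 - F j - F j.+2) *+ j.+1 =
    F m *+ m.+1 - F m.+1 *+ m - F 0%N.
Proof.
elim: m => [|m IH]; first by rewrite big_ord0 mulr0n mulr1n subr0 subrr.
by rewrite big_ord_recr /= IH; ring.
Qed.

(** Spares the check of [laplacian f = D] at x, where all the paths meet. *)
Lemma degree_ext (G : sgraph) (x : G) (D E : divisor G) :
  degree D = degree E -> (forall v, v != x -> D v = E v) -> D = E.
Proof.
move=> degDE DE; apply/ffunP => v; have [->|/DE//] := eqVneq v x.
move: degDE; rewrite /degree (bigD1 x) // [RHS](bigD1 x) //=.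
by rewrite (eq_bigr _ DE) => /addIr.
Qed.

End Laplacian.

(** * Principal divisors on the hinge graph *)

Section HingeClasses.
Local Open Scope ring_scope.

Variables (n : nat) (l : 'I_n -> nat).
Hypothesis l_ge2 : forall i, (2 <= l i)%N.

Local Notation V := (hinge_vertex l).
Local Notation vx := (inl false : V).
Local Notation vy := (inl true : V).
Local Notation vp i j := (inr (Tagged (fun i => 'I_(l i).-1) (i := i) j) : V).

Lemma sum_hinge (P : pred V) (F : V -> int) :
  \sum_(w | P w) F w =
    (if P vx then F vx else 0) + (if P vy then F vy else 0)
    + \sum_i \sum_(j | P (vp i j)) F (vp i j).
Proof.
rewrite big_sumType /=; congr (_ + _).
  by rewrite big_mkcond big_bool /= addrC.
rewrite (sig_big_dep xpredT (fun i j => P (vp i j)) (fun i j => F (vp i j))) /=.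
by apply: eq_big => [[i j]|[i j] _].
Qed.

(** Since [insub] fails at distance [l i], y needs no separate case: the Laplacian at every interior
    vertex is one second difference, even next to x or y. *)
Definition path_value (f : divisor (hinge l)) (i : 'I_n) (p : nat) : int :=
  if p is p'.+1 then
    if insub p' is Some j then f (vp i j) else f vy
  else f vx.
Arguments path_value : simpl never.

Lemma path_value_interior (f : divisor (hinge l)) i (j : 'I_(l i).-1) :
  path_value f i j.+1 = f (vp i j).
Proof. by rewrite /path_value valK. Qed.

Lemma path_value_end (f : divisor (hinge l)) i : path_value f i (l i) = f vy.
Proof.
rewrite -[X in path_value _ _ X]prednK ?(ltnW (l_ge2 i)) //.
by rewrite /path_value insubF // ltnn.
Qed.

Lemma laplacian_end (f : divisor (hinge l)) :
  laplacian f vy = (f vy - f vx) + \sum_i (f vy - path_value f i (l i).-1).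
Proof.
rewrite laplacian_sumE sum_hinge /= addr0; congr (_ + _).
apply: eq_bigr => i _.
under eq_bigr => j _ do rewrite -path_value_interior.
rewrite (eq_bigl (fun j : 'I_(l i).-1 => j == (l i).-2 :> nat)); last first.
  by move=> j; have := l_ge2 i; lia.
rewrite (big_ord1_eq +%R (fun j => f vy - path_value f i j.+1)).
have -> : (l i).-2.+1 = (l i).-1 by have := l_ge2 i; lia.
by rewrite ifT //; have := l_ge2 i; lia.
Qed.

Lemma laplacian_interior (f : divisor (hinge l)) i (j : 'I_(l i).-1) :
  laplacian f (vp i j) =
    path_value f i j.+1 *+ 2 - path_value f i j - path_value f i j.+2.
Proof.
rewrite laplacian_sumE sum_hinge /=.
rewrite (bigD1 i) //= [X in _ + (_ + X)]big1 ?addr0; last first.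
  move=> i' i'i; apply: big_pred0 => j'.
  by rewrite eq_sym (negbTE i'i).
rewrite eqxx /= -!path_value_interior.
under eq_bigr => j' _ do rewrite -path_value_interior.
rewrite (sum_neighbours (fun p => path_value f i j.+1 - path_value f i p.+1)) //.
have -> : f vx = path_value f i 0 by [].
rewrite -(path_value_end f i).
have jl := ltn_ord j.
(* The edges to y and to x supply exactly the terms that the guards of [sum_neighbours] leave
   out. *)
have -> : (if j.+2 == l i then path_value f i j.+1 - path_value f i (l i) else 0)
   = (if (j.+1 < (l i).-1)%N then 0 else path_value f i j.+1 - path_value f i j.+2).
  case: ifP => [/eqP ->|]; first by rewrite ifF //; lia.
  by case: ifP => //; lia.
have -> : (if (0 < j)%N then path_value f i j.+1 - path_value f i j.-1.+1 else 0)
   = (if j == 0%N :> nat then 0 else path_value f i j.+1 - path_value f i j).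
  by case: (nat_of_ord j).
rewrite mulr2n; case: ifP => [/eqP ->|_]; case: ifP => _; ring.
Qed.

(* The class of [D] only depends on its value at y and on these weights: in the
   critical group every vertex of path [i] at distance [p] from x is [p] times
   the first one. *)
Definition path_weight (D : divisor (hinge l)) (i : 'I_n) : int :=
  \sum_(j < (l i).-1) D (vp i j) *+ j.+1.

Lemma path_weightB (D E : divisor (hinge l)) i :
  path_weight (D - E) i = path_weight D i - path_weight E i.
Proof.
by rewrite -sumrB; apply: eq_bigr => j _; rewrite !ffunE mulrnDl mulNrn.
Qed.

Lemma path_weight_laplacian (f : divisor (hinge l)) i :
  path_weight (laplacian f) i =
    f vy - f vx + (path_value f i (l i).-1 - f vy) * (l i)%:Z.
Proof.
rewrite /path_weight.
under eq_bigr => j _ do rewrite laplacian_interior.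
rewrite sum_second_difference.
have -> : (l i).-1.+1 = l i by have := l_ge2 i; lia.
rewrite path_value_end; have -> : path_value f i 0 = f vx by [].
have := l_ge2 i; case: (l i) => // m _ /=.
by ring.
Qed.

(* The potential on path [i] solving [laplacian f = D] backwards from the value
   [t] at y and [t + q i] next to it; truncated subtraction is the positive part. *)
Definition potential (D : divisor (hinge l)) (t : int) (q : 'I_n -> int)
    (i : 'I_n) (p : nat) : int :=
  t + (l i - p)%:Z * q i - \sum_(j < (l i).-1) D (vp i j) *+ (j.+1 - p).

Lemma potential_path_value D t q i p (f : divisor (hinge l)) :
    f = [ffun v : V => match v with
         | inl b => if b then t else 0
         | inr p => potential D t q (tag p) (tagged p).+1 end] ->
    path_weight D i = t + q i * (l i)%:Z -> (p <= l i)%N ->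
  path_value f i p = potential D t q i p.
Proof.
move=> -> Di; case: p => [|p] pl.
  rewrite /path_value ffunE /potential subn0.
  have -> : \sum_(j < (l i).-1) D (vp i j) *+ (j.+1 - 0) = path_weight D i by [].
  by rewrite Di; ring.
rewrite /path_value; case: insubP => [j _ <-|]; first by rewrite ffunE.
rewrite ffunE => plN; have {plN} -> : p.+1 = l i by lia.
rewrite /potential subnn mul0r big1 ?subr0 ?addr0 // => j _.
by have -> : (j.+1 - l i = 0)%N by have := ltn_ord j; lia.
Qed.

(** Given [f], [t] is its rise from x to y and [q i] its increase from y to the vertex before y on
    path [i]. Conversely, the weight equations make the potentials solved backwards from y all
    vanish at x, so they glue. *)
Lemma principalP (D : divisor (hinge l)) : degree D = 0 ->
  (exists f, laplacian f = D) <->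
  exists (t : int) (q : 'I_n -> int),
    (forall i, path_weight D i = t + q i * (l i)%:Z) /\ D vy = t - \sum_i q i.
Proof.
move=> degD; split=> [[f <-]|[t [q [Dp Dy]]]].
  exists (f vy - f vx), (fun i => path_value f i (l i).-1 - f vy).
  split=> [i|]; first exact: path_weight_laplacian.
  by rewrite laplacian_end -sumrN; congr (_ + _); apply: eq_bigr => i _; rewrite opprB.
pose f : divisor (hinge l) := [ffun v : V => match v with
  | inl b => if b then t else 0
  | inr p => potential D t q (tag p) (tagged p).+1 end].
have fE i p : (p <= l i)%N -> path_value f i p = potential D t q i p.
  by move=> pl; apply: potential_path_value.
exists f; apply: (@degree_ext (hinge l) vx) => [|[[]|[i j]] // _].
- by rewrite degree_laplacian.
- rewrite laplacian_end Dy !ffunE subr0 -sumrN; congr (_ + _).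
  apply: eq_bigr => i _; rewrite fE ?leq_pred // /potential big1 => [|j _].
    have -> : (l i - (l i).-1 = 1)%N by have := l_ge2 i; lia.
    by ring.
  by have -> : (j.+1 - (l i).-1 = 0)%N by have := ltn_ord j; lia.
- have jl := ltn_ord j.
  rewrite laplacian_interior !fE; try by lia.
  rewrite /potential.
  have -> : (l i - j.+1 = (l i - j.+2).+1)%N by lia.
  have -> : (l i - j = (l i - j.+2).+2)%N by lia.
  (* As a function of [p], the truncated [k.+1 - p] is piecewise linear with its only kink at
     [k.+1], so the second difference of [S] at [j.+1] isolates the term [k = j]. *)
  pose S p := \sum_(k < (l i).-1) D (vp i k) *+ (k.+1 - p).
  rewrite -!/(S _).
  have SE : S j + S j.+2 - S j.+1 *+ 2 = D (vp i j).
    rewrite /S -big_split -sumrMnl -sumrB /= (bigD1 j) //= big1 => [|j' j'j].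
      have -> : (j.+1 - j.+2 = 0)%N by lia.
      by rewrite subSnn subnn; ring.
    rewrite -mulrnDr -mulrnA.
    suff -> : (j'.+1 - j + (j'.+1 - j.+2) = (j'.+1 - j.+1) * 2)%N by rewrite subrr.
    by have : (j' : nat) <> j by [move/val_inj => jj; rewrite jj eqxx in j'j]; lia.
  by rewrite -SE; ring.
Qed.

End HingeClasses.

(** * Normal forms: count, existence and uniqueness *)

Section NormalForms.
Local Open Scope ring_scope.

Variables (n : nat) (l : 'I_n -> nat).
Hypothesis l_gt0 : forall i, (0 < l i)%N.

Local Notation residues := {dffun forall i : 'I_n, 'I_(l i)}.

Definition zeros (r : residues) : nat := (\sum_(i < n) (r i == 0 :> nat))%N.

(* A pair (r, c) stands for c (y - x) plus, for each path, the vertex at distance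
   [r i] from x minus x. *)
Definition normal_form : finType := {r : residues & 'I_(zeros r).+1}.

Lemma card_residues : #|residues| = (\prod_(i < n) l i)%N.
Proof.
rewrite card_dep_ffun foldrE big_map big_enum /=.
by apply: eq_bigr => i _; rewrite card_ord.
Qed.

Lemma card_residues_zero (i : 'I_n) :
  (\sum_(r : residues) (r i == 0 :> nat) = (\prod_(j < n) l j) %/ l i)%N.
Proof.
(* The residues vanishing at [i] form a product of sets: one point at [i], everything elsewhere. *)
pose F j := [pred x : 'I_(l j) | (j == i) ==> (x == 0 :> nat)].
transitivity #|(family F : pred residues)|.
  rewrite -sum1_card [RHS]big_mkcond; apply: eq_bigr => r _.
  suff -> : (r \in family F) = (r i == 0 :> nat) by case: (_ == _).
  apply/familyP/idP => [/(_ i)|ri0 j]; rewrite inE ?eqxx //.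
  by apply/implyP => /eqP ->.
rewrite card_family foldrE big_map big_enum /= (bigD1 i) //=.
rewrite [X in (_ = X %/ _)%N](bigD1 i) //= mulKn //.
rewrite (_ : #|F i| = 1)%N ?mul1n.
  apply: eq_bigr => j ji; rewrite -[RHS]card_ord; apply: eq_card => x.
  by rewrite !inE (negbTE ji).
rewrite -(card1 (Ordinal (l_gt0 i))); apply: eq_card => x.
by rewrite !inE eqxx.
Qed.

Lemma card_normal_form :
  #|normal_form| = (\prod_(i < n) l i + \sum_(i < n) (\prod_(j < n) l j) %/ l i)%N.
Proof.
rewrite card_tagged sumnE big_map big_enum /=.
under eq_bigr => r _ do rewrite card_ord -addn1.
rewrite big_split /= sum1_card card_residues addnC; congr (_ + _)%N.
by rewrite exchange_big /=; apply: eq_bigr => i _; apply: card_residues_zero.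
Qed.

(** Applied to [s i - t]: raising [t] by one lowers the quotient exactly when the residue is
    zero. *)
Lemma divz_pred (x : int) (d : nat) : (0 < d)%N ->
  (x %/ d)%Z = ((x - 1) %/ d)%Z + (d %| x)%Z.
Proof.
move=> d0; have dn0 : d%:Z != 0 by lia.
have dp : 0 < d%:Z by lia.
have := divz_eq x d; have := divz_eq (x - 1) d.
have := modz_ge0 x dn0; have := modz_ge0 (x - 1) dn0.
have := ltz_pmod x dp; have := ltz_pmod (x - 1) dp.
rewrite (sameP dvdz_mod0P eqP).
move: (x %/ d)%Z ((x - 1) %/ d)%Z (x %% d)%Z ((x - 1) %% d)%Z => a b c e.
by case: eqP => [->|/eqP c0] /= *; nia.
Qed.

Lemma normal_form_exists (C : int) (s : 'I_n -> int) :
  exists (u : normal_form) (t : int) (q : 'I_n -> int),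
    (forall i, s i - (tag u i : nat)%:Z = t + q i * (l i)%:Z) /\
    C - (tagged u : nat)%:Z = t - \sum_i q i.
Proof.
(* After subtracting [t] from every weight, the reduced coordinate at y is
   [c t]; it drops by 1 + (number of zero residues) when [t] grows by 1, so
   its last nonnegative value lies in the normal-form range. *)
pose Q (t : int) i := ((s i - t) %/ l i)%Z.
pose c (t : int) : int := C - t + \sum_i Q t i.
pose Z (t : int) : nat := (\sum_i (l i %| (s i - t)%R)%Z)%N.
have step t : c t = c (t + 1) + 1 + (Z t)%:Z.
  have : \sum_i Q t i = \sum_i Q (t + 1) i + (Z t)%:Z.
    rewrite /Z -natz natr_sum -big_split /=; apply: eq_bigr => i _.
    by rewrite /Q divz_pred // natz opprD addrA.
  by rewrite /c => ->; ring.
(* If [c t] exceeds [Z t], then [c (t + 1)] is smaller but still nonnegative. *)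
have descend (N : nat) : forall t, c t = N%:Z -> exists t', 0 <= c t' <= (Z t')%:Z.
  elim/ltn_ind: N => N IH t ctN.
  have [cZ|Zc] := leP (c t) (Z t)%:Z; first by exists t; rewrite cZ ctN.
  have /IH/(_ (t + 1)) : (`|c (t + 1)%R|%N < N)%N by have := step t; lia.
  by apply; have := step t; lia.
have [t /andP[ct0 ctZ]] : exists t, 0 <= c t <= (Z t)%:Z.
  (* So negative that [C - t0] and every [s i - t0] are nonnegative, hence [c t0] too. *)
  pose t0 : int := - (`|C|%N + \sum_i `|s i|%N)%N%:Z.
  apply: (descend `|c t0|%N t0); rewrite gez0_abs // /c addr_ge0 //.
    by rewrite /t0; lia.
  apply: sumr_ge0 => i _; rewrite divz_ge0 ?ltz_nat //.
  by rewrite /t0 (bigD1 i) //=; lia.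
have rP i : (`|((s i - t) %% l i)%Z|%N < l i)%N.
  have := ltz_pmod (s i - t) (_ : 0 < (l i)%:Z); have := @modz_ge0 (s i - t) (l i).
  by have := l_gt0 i; lia.
pose r : residues := [ffun i => Ordinal (rP i)].
have rE i : (r i : nat)%:Z = ((s i - t) %% l i)%Z.
  by rewrite ffunE /= gez0_abs // modz_ge0 //; have := l_gt0 i; lia.
have ZE : zeros r = Z t.
  apply: eq_bigr => i _; congr nat_of_bool.
  by rewrite (sameP dvdz_mod0P eqP) -rE.
have cP : (`|c t|%N < (zeros r).+1)%N by rewrite ZE; lia.
exists (Tagged (fun r => 'I_(zeros r).+1) (Ordinal cP)), t, (Q t); split=> [i|] /=.
  by rewrite rE /Q; have := divz_eq (s i - t) (l i); lia.
by rewrite gez0_abs // /c; ring.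
Qed.

(** If [t > 0], residue bounds force [q i <= 0], and [q i <= -1] where the residue of [u] is zero.
    The coordinates at y would then differ by more than [zeros], the largest value allowed for
    [u]. *)
Lemma normal_form_shift_le0 (u v : normal_form) (t : int) (q : 'I_n -> int) :
    (forall i, (tag u i : nat)%:Z - (tag v i : nat)%:Z = t + q i * (l i)%:Z) ->
    (tagged u : nat)%:Z - (tagged v : nat)%:Z = t - \sum_i q i ->
  t <= 0.
Proof.
case: u v => [r c] [r' c'] /= rr' cc'; rewrite leNgt; apply/negP => t0.
have : \sum_i q i <= - (zeros r)%:Z.
  rewrite /zeros -natz natr_sum -sumrN; apply: ler_sum => i _.
  have := rr' i; have := ltn_ord (r i).
  by case: eqP => [->|_] /=; nia.
move: (ltn_ord c) cc'; move: (nat_of_ord c) (nat_of_ord c') => c1 c2.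
by move: (zeros r) (\sum_i q i) => z S; lia.
Qed.

(** Bounding the shift in both directions gives [t = 0]; residues then differ by a multiple of [l i]
    smaller than [l i]. *)
Lemma normal_form_inj (u v : normal_form) (t : int) (q : 'I_n -> int) :
    (forall i, (tag u i : nat)%:Z - (tag v i : nat)%:Z = t + q i * (l i)%:Z) ->
    (tagged u : nat)%:Z - (tagged v : nat)%:Z = t - \sum_i q i ->
  u = v.
Proof.
move=> uv_tag uv_val; have t0 : t = 0.
  have := normal_form_shift_le0 uv_tag uv_val.
  have := @normal_form_shift_le0 v u (- t) (fun i => - q i).
  rewrite sumrN => vu_le; have : - t <= 0.
    by apply: vu_le => [i|]; rewrite -opprB ?uv_tag ?uv_val; ring.
  by lia.
have q0 i : q i = 0.
  have := uv_tag i; have := ltn_ord (tag u i); have := ltn_ord (tag v i); nia.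
case: u v uv_tag uv_val => [r c] [r' c'] /= rr' cc'.
have {rr'} rr' : r = r'.
  apply/ffunP => i; apply/val_inj => /=.
  by have := rr' i; rewrite q0 t0; lia.
case: r' / rr' c' cc' => c'; rewrite big1 => [cc'|i _]; last exact: q0.
by congr existT; apply/val_inj => /=; lia.
Qed.

End NormalForms.

(** * Normal forms as representatives of the critical group *)

Section HingeRepresentatives.
Local Open Scope ring_scope.
Local Open Scope quotient_scope.

Variables (n : nat) (l : 'I_n -> nat).

Local Notation V := (hinge_vertex l).
Local Notation vx := (inl false : V).
Local Notation vy := (inl true : V).

(** A zero residue puts no chip on its path: distance 0 is x itself. *)
Definition chip_weight (u : normal_form l) (v : V) : int :=
  match v with
  | inl _ => (tagged u : nat)%:Z
  | inr p => ((tagged p).+1 == tag u (tag p) :> nat)%:Z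
  end.

(* The value of [chip_weight u] at x is irrelevant: x balances the degree. *)
Definition chips (u : normal_form l) : divisor (hinge l) :=
  [ffun v : V => if v == vx then - \sum_(w | w != vx) chip_weight u w
                 else chip_weight u v].

Lemma chips_degree0 u : chips u \in @degree0 (hinge l).
Proof.
rewrite inE /degree (bigD1 vx) //= ffunE eqxx.
rewrite [X in _ + X](eq_bigr (chip_weight u)) ?addNr // => v vNx.
by rewrite ffunE (negbTE vNx).
Qed.

Lemma chips_end u : chips u vy = (tagged u : nat)%:Z.
Proof. by rewrite ffunE. Qed.

Lemma path_weight_chips u i : path_weight (chips u) i = (tag u i : nat)%:Z.
Proof.
(* For residue 0 the truncated predecessor still selects [j = 0], so the summand must be set to
   0. *)
transitivity (\sum_(j < (l i).-1 | j == (tag u i).-1 :> nat)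
  (if (tag u i : nat) == 0%N then 0 else j.+1%:Z)).
  rewrite /path_weight [RHS]big_mkcond; apply: eq_bigr => j _.
  rewrite ffunE /=; case: (tag u i : nat) => [|m]; first by rewrite mul0rn if_same.
  by rewrite eqSS; case: ifP => _; [exact: natz | exact: mul0rn].
rewrite (big_ord1_eq +%R (fun j => if (tag u i : nat) == 0%N then 0 else j.+1%:Z)).
have := ltn_ord (tag u i); case: (nat_of_ord (tag u i)) => [|m] /= ml.
  by rewrite if_same.
by rewrite ifT // ltn_predRL.
Qed.

Definition chip_class (u : normal_form l) : critical_group (hinge l) :=
  \pi_(critical_group (hinge l)) (Divisor0 (chips_degree0 u)).

Hypothesis l_ge2 : forall i, (2 <= l i)%N.

Lemma eq_class (D E : divisor0 (hinge l)) :
  \pi_(critical_group (hinge l)) D = \pi_(critical_group (hinge l)) E <->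
  exists (t : int) (q : 'I_n -> int),
    (forall i, path_weight D i - path_weight E i = t + q i * (l i)%:Z) /\
    (D : divisor _) vy - (E : divisor _) vy = t - \sum_i q i.
Proof.
have degDE : degree (val D - val E) = 0.
  by rewrite degreeB; case: D E => [D /eqP /= ->] [E /eqP /= ->].
have := principalP l_ge2 degDE.
rewrite !ffunE => prinP.
split=> [/eqP|DE].
  rewrite -Quotient.idealrBE => /asboolP; rewrite raddfB => /prinP [t [q [DE1 DE2]]].
  by exists t, q; split=> // i; rewrite -path_weightB.
apply/eqP; rewrite -Quotient.idealrBE; apply/asboolP; rewrite raddfB.
apply/prinP; case: DE => t [q [DE1 DE2]].
by exists t, q; split=> // i; rewrite path_weightB.
Qed.

Lemma chip_class_inj : injective chip_class.
Proof.
move=> u v /eq_class [t [q [uv_tag uv_val]]].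
apply: (normal_form_inj (t := t) (q := q)) => [i|].
  by have := uv_tag i; rewrite !path_weight_chips.
by move: uv_val; rewrite /= !chips_end.
Qed.

Lemma chip_class_surj (z : critical_group (hinge l)) : exists u, chip_class u = z.
Proof.
elim/quotW: z => D.
have l_gt0 i : (0 < l i)%N by have := l_ge2 i; lia.
have [u [t [q [u_tag u_val]]]] :=
  normal_form_exists l_gt0 ((D : divisor _) vy) (path_weight D).
exists u; apply/esym/eq_class; exists t, q.
by split=> [i|]; rewrite /= ?path_weight_chips ?chips_end.
Qed.

End HingeRepresentatives.

Local Open Scope nat_scope.
Local Open Scope classical_set_scope.
Local Open Scope card_scope.

(* The quotients a %/ (k i - 1) are exact: each k i - 1 > 0 is a factor of a. *)
Theorem theorem4p1 (n : nat) (k : 'I_n -> nat)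
    (n_ge2 : 2 <= n) (k_ge3 : forall i, 3 <= k i) :
  let a := \prod_(i < n) (k i - 1) in
  [set: critical_group (hinge (fun i => k i - 1))]
    #= `I_(a + \sum_(i < n) a %/ (k i - 1)).
Proof.
pose l i := k i - 1; cbv zeta.
have l_ge2 i : 2 <= l i by have := k_ge3 i; rewrite /l; lia.
have l_gt0 i : 0 < l i by exact: ltnW.
rewrite -(card_normal_form l_gt0) (card_eqr card_II).
(* Numbering the normal forms turns [chip_class] into a bijection from an ordinal. *)
pose rep (i : 'I_#|normal_form l|) := chip_class (enum_val i).
have -> : [set: critical_group (hinge l)] = [set rep i | i in [set: _]].
  apply/seteqP; split=> // z _; have [u <-] := chip_class_surj l_ge2 z.
  by exists (enum_rank u); rewrite // /rep enum_rankK.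
by apply: inj_card_eq => i j _ _ /(chip_class_inj l_ge2) /enum_val_inj.
Qed.
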